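(* Let $\mathcal{D}=\lbrace(x_k,y_k)\rbrace_{k=1}^M$ be a dataset with $x_k\in\mathbb{R}^n$ and $y_k\in\lbrace0,1\rbrace$, and let $f$ and $u_k=\nabla f_k$ be the associated logistic regression objective and single-sample gradients. If $\mathcal{D}$ satisfies the features consistency property, then the batch gradient estimate satisfies the direction condition: there is $\gamma\in(0,1]$ such that for every batch size $B\geqslant1$, every batch $I=(i_1,\dots,i_B)\in\lbrace1,\dots,M\rbrace^B$ and every $\theta\in\mathbb{R}^n$, the estimate $\widetilde{\nabla} f(\theta)=\frac1B\sum_{j=1}^Bu_{i_j}(\theta)$ satisfies $$\langle\widetilde{\nabla} f(\theta),\nabla f(\theta)\rangle\geqslant\gamma\|\widetilde{\nabla} f(\theta)\|_2\|\nabla f(\theta)\|_2 .$$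
   Context: Logistic regression: $\sigma(t)=\frac{1}{1+e^{-t}}$; $f_k(\theta)=y_k\ln\sigma(x_k^T\theta)+(1-y_k)\ln\left(1-\sigma(x_k^T\theta)\right)$; $f(\theta)=\frac1M\sum_{k=1}^Mf_k(\theta)$; $u_k(\theta)=\nabla f_k(\theta)=x_k\left(y_k\left(1-\sigma(x_k^T\theta)\right)-(1-y_k)\sigma(x_k^T\theta)\right)$. Features consistency of $\mathcal{D}$: there exists $\Upsilon\in(0,1]$ such that for all $i,k\in\lbrace1,\dots,M\rbrace$: if $y_i=y_k$ then $\langle x_i,x_k\rangle\geqslant\Upsilon\|x_i\|_2\|x_k\|_2$, and if $y_i\neq y_k$ then $\langle x_i,x_k\rangle\leqslant-\Upsilon\|x_i\|_2\|x_k\|_2$. *)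

(* Defs.v *)
From HB Require Import structures.
From mathcomp Require Import all_boot all_order all_algebra.
From mathcomp Require Import all_classical all_reals all_analysis.

Set Implicit Arguments.
Unset Strict Implicit.
Unset Printing Implicit Defensive.

Import Order.TTheory GRing.Theory Num.Theory.
Import numFieldNormedType.Exports.

Local Open Scope ring_scope.

(* The library norm on ['rV[R]_n] is the max norm, so the Euclidean one is
   introduced here. The two are equivalent, hence derivatives agree. *)
Definition dotv (R : realType) (n : nat) (u v : 'rV[R]_n) : R :=
  \sum_(i < n) u 0 i * v 0 i.

Definition norm2 (R : realType) (n : nat) (u : 'rV[R]_n) : R :=
  Num.sqrt (dotv u u).

(* Vector of partial derivatives; meaningful where they exist, since the
   library's ['D_v] is total. *)
Definition grad (R : realType) (n : nat) (g : 'rV[R]_n -> R)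
    (theta : 'rV[R]_n) : 'rV[R]_n :=
  \row_(i < n) 'D_(delta_mx 0 i) g theta.

Definition sigmoid (R : realType) (t : R) : R := (1 + expR (- t))^-1.

(* The labels in {0, 1} are booleans, coerced to R by [(b%:R)]. *)
Definition sample_loglik (R : realType) (n M : nat)
    (x : 'I_M -> 'rV[R]_n) (y : 'I_M -> bool) (k : 'I_M)
    (theta : 'rV[R]_n) : R :=
  (y k)%:R * ln (sigmoid (dotv (x k) theta)) +
  (1 - (y k)%:R) * ln (1 - sigmoid (dotv (x k) theta)).

Definition loglik (R : realType) (n M : nat)
    (x : 'I_M -> 'rV[R]_n) (y : 'I_M -> bool) (theta : 'rV[R]_n) : R :=
  M%:R^-1 * \sum_(k < M) sample_loglik x y k theta.

Definition sample_grad (R : realType) (n M : nat)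
    (x : 'I_M -> 'rV[R]_n) (y : 'I_M -> bool) (k : 'I_M)
    (theta : 'rV[R]_n) : 'rV[R]_n :=
  grad (sample_loglik x y k) theta.

(* A batch is an ordered tuple of indices, repetitions allowed. *)
Definition batch_grad (R : realType) (n M : nat)
    (x : 'I_M -> 'rV[R]_n) (y : 'I_M -> bool) (B : nat) (I : B.-tuple 'I_M)
    (theta : 'rV[R]_n) : 'rV[R]_n :=
  B%:R^-1 *: \sum_(j < B) sample_grad x y (tnth I j) theta.

Definition features_consistency (R : realType) (n M : nat)
    (x : 'I_M -> 'rV[R]_n) (y : 'I_M -> bool) : Prop :=
  exists Upsilon : R, [/\ 0 < Upsilon, Upsilon <= 1 &
    forall i k : 'I_M,
      (y i = y k -> Upsilon * norm2 (x i) * norm2 (x k) <= dotv (x i) (x k)) /\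
      (y i <> y k ->
        dotv (x i) (x k) <= - (Upsilon * norm2 (x i) * norm2 (x k)))].

(* Main.v *)
(** Each single-sample gradient is [(y_k - sigma) x_k], whose scalar factor is
    positive for label 1 and negative for label 0, so features consistency says
    that any two of them, even at different points, form an angle of cosine at
    least Upsilon. Expanding the inner product of two sums of such vectors
    bilinearly and using the triangle inequality gives the same bound for the
    sums, so gamma = Upsilon works. *)
Require Import Defs.
From mathcomp Require Import all_boot all_order all_algebra.
From mathcomp Require Import all_classical all_reals all_analysis.
From mathcomp Require Import ring lra.
Import Order.TTheory GRing.Theory Num.Theory.
Import numFieldNormedType.Exports.
Local Open Scope ring_scope.

(** * Euclidean inner product, norm, and directional derivatives of ridge functions *)

Section Euclidean.
Context {R : realType} {n : nat}.
Implicit Types (u v w : 'rV[R]_n) (c : R).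

Lemma dotvC u v : dotv u v = dotv v u.
Proof. by apply: eq_bigr => i _; rewrite mulrC. Qed.

Lemma dotvZl c u v : dotv (c *: u) v = c * dotv u v.
Proof. by rewrite mulr_sumr; apply: eq_bigr => i _; rewrite mxE mulrA. Qed.

Lemma dotvZr c u v : dotv u (c *: v) = c * dotv u v.
Proof. by rewrite dotvC dotvZl dotvC. Qed.

Lemma dotvDl u v w : dotv (u + v) w = dotv u w + dotv v w.
Proof. by rewrite -big_split; apply: eq_bigr => i _; rewrite mxE mulrDl. Qed.

Lemma dotvDr u v w : dotv w (u + v) = dotv w u + dotv w v.
Proof. by rewrite dotvC dotvDl !(dotvC w). Qed.

Lemma dotv0l v : dotv 0 v = 0.
Proof. by rewrite -(scale0r v) dotvZl mul0r. Qed.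

Lemma dotv_suml m (a : 'I_m -> 'rV[R]_n) v :
  dotv (\sum_i a i) v = \sum_i dotv (a i) v.
Proof.
by apply: (big_morph (fun u => dotv u v)); [move=> ? ?; exact: dotvDl | exact: dotv0l].
Qed.

Lemma dotv_sumr m (a : 'I_m -> 'rV[R]_n) v :
  dotv v (\sum_i a i) = \sum_i dotv v (a i).
Proof. by rewrite dotvC dotv_suml; apply: eq_bigr => i _; rewrite dotvC. Qed.

Lemma dotvv_ge0 u : 0 <= dotv u u.
Proof. by apply: sumr_ge0 => i _; rewrite -expr2 sqr_ge0. Qed.

Lemma norm2_ge0 u : 0 <= norm2 u.
Proof. exact: sqrtr_ge0. Qed.

Lemma sqr_norm2 u : norm2 u ^+ 2 = dotv u u.
Proof. by rewrite sqr_sqrtr // dotvv_ge0. Qed.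

Lemma norm2Z c u : norm2 (c *: u) = `|c| * norm2 u.
Proof.
by rewrite /norm2 dotvZl dotvZr mulrA -expr2 sqrtrM ?sqr_ge0 // sqrtr_sqr.
Qed.

Lemma norm2_eq0 u : norm2 u = 0 -> u = 0.
Proof.
move=> u0; have /eqP := sqr_norm2 u.
rewrite u0 expr0n eq_sym psumr_eq0 => [/allP uz|i _]; last by rewrite -expr2 sqr_ge0.
apply/rowP => i; apply/eqP; rewrite mxE -sqrf_eq0 expr2.
by apply: uz; rewrite mem_index_enum.
Qed.

(** Cauchy-Schwarz: the squared length of |v| u - |u| v is 2 |u| |v| (|u| |v| - <u, v>), and it is
    nonnegative. Zero norms are treated first so that |u| |v| can be cancelled. *)
Lemma dotv_le_norm2 u v : dotv u v <= norm2 u * norm2 v.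
Proof.
have [/norm2_eq0 ->|u0] := eqVneq (norm2 u) 0.
  by rewrite dotv0l mulr_ge0 ?norm2_ge0.
have [/norm2_eq0 ->|v0] := eqVneq (norm2 v) 0.
  by rewrite dotvC dotv0l mulr_ge0 ?norm2_ge0.
have uv0 : 0 < norm2 u * norm2 v by rewrite mulr_gt0 ?lt0r ?u0 ?v0 ?norm2_ge0.
have := dotvv_ge0 (norm2 v *: u + - norm2 u *: v).
rewrite dotvDl !dotvDr !dotvZl !dotvZr (dotvC v u) -!sqr_norm2 => h.
rewrite -(ler_pM2l uv0); nra.
Qed.

Lemma ler_norm2D u v : norm2 (u + v) <= norm2 u + norm2 v.
Proof.
rewrite -(ler_pXn2r (ltn0Sn 1)) ?nnegrE ?addr_ge0 ?norm2_ge0 //.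
rewrite sqr_norm2 dotvDl !dotvDr (dotvC v u) -!sqr_norm2.
have := dotv_le_norm2 u v; lra.
Qed.

Lemma ler_norm2_sum m (a : 'I_m -> 'rV[R]_n) :
  norm2 (\sum_i a i) <= \sum_i norm2 (a i).
Proof.
elim/big_ind2: _ => [|u s v t us vt|//].
  by rewrite /norm2 dotv0l sqrtr0.
by apply: le_trans (ler_norm2D _ _) _; exact: lerD.
Qed.

Lemma dotv_sum_ge (c : R) m p (a : 'I_m -> 'rV[R]_n) (b : 'I_p -> 'rV[R]_n) :
  0 <= c ->
  (forall i j, c * norm2 (a i) * norm2 (b j) <= dotv (a i) (b j)) ->
  c * norm2 (\sum_i a i) * norm2 (\sum_j b j) <= dotv (\sum_i a i) (\sum_j b j).
Proof.
move=> c0 ab.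
(* The double sum of the pairwise bounds factors as c times the two sums of norms; as c >= 0, the
   triangle inequality can be applied in each factor. *)
apply: (@le_trans _ _ (\sum_i \sum_j c * norm2 (a i) * norm2 (b j))).
  have -> : \sum_i \sum_j c * norm2 (a i) * norm2 (b j) =
            c * (\sum_i norm2 (a i)) * (\sum_j norm2 (b j)).
    by rewrite [c * _]mulr_sumr mulr_suml; apply: eq_bigr => i _; rewrite mulr_sumr.
  by rewrite ler_pM ?mulr_ge0 ?norm2_ge0 ?ler_wpM2l ?ler_norm2_sum.
rewrite dotv_suml; apply: ler_sum => i _.
by rewrite dotv_sumr; apply: ler_sum => j _.
Qed.

Lemma dotv_scale_ge (c s t : R) u v : 0 <= s -> 0 <= t ->
  c * norm2 u * norm2 v <= dotv u v ->
  c * norm2 (s *: u) * norm2 (t *: v) <= dotv (s *: u) (t *: v).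
Proof.
move=> s0 t0 uv; rewrite dotvZl dotvZr !norm2Z !ger0_norm //.
have := ler_wpM2l (mulr_ge0 s0 t0) uv; lra.
Qed.

(** Along the line a + t v the inner product with x is the affine function [h] of t, so the
    one-variable chain rule for [g \o h] at 0 suffices. *)
Lemma is_derive_comp_dotv (g : R -> R) x a v (l : R) :
  is_derive (dotv x a) 1 g l ->
  is_derive a v (fun u => g (dotv x u)) (l * dotv x v).
Proof.
move=> gl; pose h (t : R) := t * dotv x v + dotv x a.
have dh : is_derive (0 : R) (1 : R) h (dotv x v).
  rewrite /h.
  have -> : (fun t : R => t * dotv x v + dotv x a) =
            (dotv x v) \*: (id : R -> R) + cst (dotv x a).
    by apply/funext => t; rewrite /= /GRing.add /= /GRing.scale /= mulrC.
  by apply: is_derive_eq; rewrite addr0 /GRing.scale /= mulr1.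
have gl' : is_derive (h 0) 1 g l by rewrite /h mul0r add0r.
have [d1 d2] := is_derive1_comp gl' dh.
(* Both difference quotients are the same function of t, so existence of the limit and its value
   transfer together. *)
have E : (fun t : R => t^-1 *: (((g \o h) \o shift 0) (t *: 1) - (g \o h) 0)) =
  (fun t : R => t^-1 *: (((fun u => g (dotv x u)) \o shift a) (t *: v) - g (dotv x a))).
  apply/funext => t.
  by rewrite /= /h dotvDr dotvZr addr0 /GRing.scale /= mulr1 mul0r add0r.
by split; [rewrite /derivable -E | rewrite /derive -E].
Qed.

End Euclidean.

(** * One-variable calculus of the sigmoid and of the log-likelihood *)

Section Sigmoid.
Context {R : realType}.
Implicit Types t : R.

Lemma sigmoid_gt0 t : 0 < sigmoid t.
Proof. by rewrite invr_gt0 addr_gt0 ?expR_gt0. Qed.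

Lemma sigmoid_lt1 t : sigmoid t < 1.
Proof. by rewrite invf_lt1 ?addr_gt0 ?expR_gt0 // ltrDl expR_gt0. Qed.

Lemma is_derive_sigmoid t :
  is_derive t 1 (@sigmoid R) (sigmoid t * (1 - sigmoid t)).
Proof.
have e0 : 1 + expR (- t) != 0 by rewrite gt_eqF ?addr_gt0 ?expR_gt0.
have d : is_derive t 1 (fun s : R => 1 + expR (- s)) (- expR (- t)).
  have d1 : is_derive t 1 ((@expR R) \o -%R) (expR (- t) * -1) by exact: is_derive1_comp.
  have d2 : is_derive t 1 (cst (1 : R) + (@expR R \o -%R)) (0 + expR (- t) * -1) by exact: is_deriveD.
  by apply: is_derive_eq d2 _; rewrite add0r mulrN1.
have dV := is_deriveV (f := fun s : R => 1 + expR (- s)) e0 d.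
by apply: (is_derive_eq (f := @sigmoid R) dV); rewrite /sigmoid /GRing.scale /=; field.
Qed.

(** Each label kills one of the two logarithms; by sigma' = sigma (1 - sigma) the other has
    derivative 1 - sigma or - sigma, which is b - sigma in both cases. *)
Lemma is_derive_loglik1 (b : bool) t :
  is_derive t 1
    (fun s : R => b%:R * ln (sigmoid s) + (1 - b%:R) * ln (1 - sigmoid s))
    (b%:R - sigmoid t).
Proof.
have s0 := sigmoid_gt0 t; have s1 : 0 < 1 - sigmoid t by rewrite subr_gt0 sigmoid_lt1.
have ds := is_derive_sigmoid t.
case: b.
  have d := is_derive1_comp (is_derive1_ln s0) ds.
  have -> : (fun s : R => true%:R * ln (sigmoid s) + (1 - true%:R) * ln (1 - sigmoid s))
      = @ln R \o @sigmoid R.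
    by apply/funext => s /=; rewrite mul1r subrr mul0r addr0.
  by apply: is_derive_eq d _; rewrite mulKf ?gt_eqF.
have d1 : is_derive t 1 (cst (1 : R) - @sigmoid R) (0 - sigmoid t * (1 - sigmoid t)).
  exact: is_deriveB.
have d := is_derive1_comp (is_derive1_ln (s1 : 0 < (cst (1 : R) - @sigmoid R) t)) d1.
have -> : (fun s : R => false%:R * ln (sigmoid s) + (1 - false%:R) * ln (1 - sigmoid s))
    = @ln R \o (cst (1 : R) - @sigmoid R).
  by apply/funext => s /=; rewrite mul0r add0r subr0 mul1r.
apply: is_derive_eq d _.
change ((1 - sigmoid t)^-1 * (0 - sigmoid t * (1 - sigmoid t)) = 0 - sigmoid t).
by field; rewrite gt_eqF.
Qed.

End Sigmoid.

(** * Gradients of the log-likelihood and the angles between them *)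

Section Gradients.
Context {R : realType} {n M : nat} (x : 'I_M -> 'rV[R]_n) (y : 'I_M -> bool).

Lemma is_derive_sample_loglik k theta v :
  is_derive theta v (sample_loglik x y k)
    (((y k)%:R - sigmoid (dotv (x k) theta)) * dotv (x k) v).
Proof. exact: (is_derive_comp_dotv _ _ _ _ _ (is_derive_loglik1 (y k) _)). Qed.

Lemma dotv_delta (u : 'rV[R]_n) i : dotv u (delta_mx 0 i) = u 0 i.
Proof.
rewrite /dotv (bigD1 i) //= big1 => [|j ji]; rewrite mxE !eqxx.
  by rewrite mulr1 addr0.
by rewrite (negPf ji) mulr0.
Qed.

(** The usual factor y (1 - sigma) - (1 - y) sigma simplifies to y - sigma. *)
Lemma sample_gradE k theta :
  sample_grad x y k theta = ((y k)%:R - sigmoid (dotv (x k) theta)) *: x k.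
Proof.
apply/rowP => i; rewrite !mxE.
by have [_ ->] := is_derive_sample_loglik k theta (delta_mx 0 i); rewrite dotv_delta.
Qed.

Lemma grad_loglikE theta :
  grad (loglik x y) theta = M%:R^-1 *: \sum_k sample_grad x y k theta.
Proof.
apply/rowP => i; rewrite !mxE summxE.
(* Existence of each partial derivative is recorded along with its value, as the sum rule
   requires. *)
have d k : is_derive theta (delta_mx 0 i) (sample_loglik x y k)
    (sample_grad x y k theta 0 i).
  rewrite sample_gradE mxE -dotv_delta; exact: is_derive_sample_loglik.
have -> : loglik x y = M%:R^-1 \*: \sum_(k < M) sample_loglik x y k.
  by apply/funext => t; rewrite /loglik /= fct_sumE.
by have [_ ->] := is_deriveZ M%:R^-1 (is_derive_sum d).
Qed.

Lemma sample_grad_dotv_ge (c : R) i k theta eta :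
  (y i = y k -> c * norm2 (x i) * norm2 (x k) <= dotv (x i) (x k)) ->
  (y i <> y k -> dotv (x i) (x k) <= - (c * norm2 (x i) * norm2 (x k))) ->
  c * norm2 (sample_grad x y i theta) * norm2 (sample_grad x y k eta)
    <= dotv (sample_grad x y i theta) (sample_grad x y k eta).
Proof.
rewrite !sample_gradE.
set s := sigmoid _; set t := sigmoid _.
have [s0 s1] : 0 < s /\ s < 1 by rewrite sigmoid_gt0 sigmoid_lt1.
have [t0 t1] : 0 < t /\ t < 1 by rewrite sigmoid_gt0 sigmoid_lt1.
rewrite dotvZl dotvZr !norm2Z.
have s1' : 0 < 1 - s by rewrite subr_gt0.
have t1' : 0 < 1 - t by rewrite subr_gt0.
(* In each case the consistency bound is multiplied by the positive product of the absolute values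
   of the two factors; for different labels the factors have opposite signs, which turns the upper
   bound into a lower one. *)
case: (y i); case: (y k) => /= same diff;
  rewrite ?sub0r ?normrN !gtr0_norm //.
- have := ler_wpM2l (ltW (mulr_gt0 s1' t1')) (same erefl); lra.
- have ne : true <> false by [].
  have := ler_wpM2l (ltW (mulr_gt0 s1' t0)) (diff ne); lra.
- have ne : false <> true by [].
  have := ler_wpM2l (ltW (mulr_gt0 s0 t1')) (diff ne); lra.
- have := ler_wpM2l (ltW (mulr_gt0 s0 t0)) (same erefl); lra.
Qed.

End Gradients.

Theorem theorem7p2 (R : realType) (n M : nat) (hM : (0 < M)%N)
    (x : 'I_M -> 'rV[R]_n) (y : 'I_M -> bool)
    (hD : features_consistency x y) :
  exists gamma : R, [/\ 0 < gamma, gamma <= 1 &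
    forall (B : nat) (I : B.-tuple 'I_M) (theta : 'rV[R]_n), (1 <= B)%N ->
      gamma * norm2 (batch_grad x y I theta) * norm2 (grad (loglik x y) theta)
        <= dotv (batch_grad x y I theta) (grad (loglik x y) theta)].
Proof.
case: hD => c [c0 c1 hc]; exists c; split=> // B I theta _.
rewrite grad_loglikE /batch_grad.
(* The averaging factors 1/B and 1/M are removed, leaving a sum over the batch against a sum over
   the dataset. *)
apply: dotv_scale_ge; rewrite ?invr_ge0 ?ler0n //.
apply: dotv_sum_ge => [|j k]; first exact: ltW.
by have [same diff] := hc (tnth I j) k; exact: sample_grad_dotv_ge.
Qed.
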